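(* Let $n$ be a positive integer, $q\in K$ an $n$-th root of unity of order $d$, and $\mu\in K$. Write $A=A(n,d,\mu,q)$ and $t=\frac{n}{d}-1$. (i) If $\mu\neq 0$, then as algebras $A\cong KZ_d^a/J^d\times M_d(K)\times\cdots\times M_d(K)$ (with $t$ copies of $M_d(K)$). (ii) If $\mu=0$, then as algebras $A\cong KZ_d^a/J^d\times KZ_d^a/J^d\times\cdots\times KZ_d^a/J^d$ (with $\frac{n}{d}$ copies of $KZ_d^a/J^d$).
   Context: $K$ is a field of characteristic $0$ containing all roots of unity. $A(n,d,\mu,q)$ is the associative $K$-algebra generated by $g,x$ with relations $g^n=1$, $x^d=\mu(1-g^d)$, $xg=qgx$. $Z_d$ is the basic cycle: the quiver with $d$ vertices $e_0,\dots,e_{d-1}$ and exactly one arrow from $e_i$ to $e_{i+1}$ for each $i$ (indices modulo $d$); $KZ_d^a$ is its path algebra over $K$ and $J$ is the ideal generated by all arrows. $M_d(K)$ is the algebra of $d\times d$ matrices over $K$. *)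

(* Defs.v *)
From HB Require Import structures.
From mathcomp Require Import all_boot all_order all_algebra.
From mathcomp Require Import finmap monalg boolp.

Set Implicit Arguments.
Unset Strict Implicit.
Unset Printing Implicit Defensive.

Import GRing.Theory.
Local Open Scope ring_scope.
Local Open Scope quotient_scope.

Definition tsideal_closed (A : pzRingType) (S : A -> Prop) : Prop :=
  [/\ S 0, forall u v, S u -> S v -> S (u - v),
      forall a u, S u -> S (a * u) & forall a u, S u -> S (u * a)].

HB.mixin Record isTwoSidedIdeal (A : pzRingType) (S : A -> bool) := {
  tsideal_closed_subproof : tsideal_closed S
}.

#[short(type="tsideal")]
HB.structure Definition TwoSidedIdeal (A : pzRingType) :=
  {S of GRing.ZmodClosed A S & isTwoSidedIdeal A S}.

Section Ideals.
Variable A : pzRingType.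

Definition ideal_gen_pred (S : A -> Prop) : A -> bool :=
  fun x => `[< forall T : A -> Prop,
                 tsideal_closed T -> (forall s, S s -> T s) -> T x >].

Fact ideal_gen_closed S : tsideal_closed (ideal_gen_pred S).
Proof.
split=> [|u v /asboolP Su /asboolP Sv|a u /asboolP Su|a u /asboolP Su];
  apply/asboolP => T cT sT; case: (cT) => T0 TB Tl Tr.
- exact: T0.
- by apply: TB; [exact: Su | exact: Sv].
- by apply: Tl; exact: Su.
- by apply: Tr; exact: Su.
Qed.

Fact ideal_gen_zmod_closed S : zmod_closed (ideal_gen_pred S).
Proof. by have [S0 SB _ _] := ideal_gen_closed S; split. Qed.

HB.instance Definition _ S :=
  GRing.isZmodClosed.Build A (ideal_gen_pred S) (ideal_gen_zmod_closed S).
HB.instance Definition _ S :=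
  isTwoSidedIdeal.Build A (ideal_gen_pred S) (ideal_gen_closed S).

Definition ideal_gen (S : A -> Prop) : tsideal A :=
  TwoSidedIdeal.clone A (ideal_gen_pred S) _.

Definition ideal_pow (I : tsideal A) (k : nat) : tsideal A :=
  ideal_gen (fun x => exists s : k.-tuple A,
                        (forall i, tnth s i \in I) /\ x = \prod_(i < k) tnth s i).
End Ideals.

(* The quotient of a K-algebra by a two-sided ideal, as a ring and a           *)
(* K-module. It is not declared as an algType because that structure requires  *)
(* 1 <> 0, which fails for the unit ideal; the compatibility of scaling with   *)
(* multiplication is quot_scalerAl and quot_scalerAr.                          *)

Section QuotientAlgebra.
Variables (K : pzRingType) (A : algType K) (I : tsideal A).

Definition alg_quot : Type := Quotient.quot I.

HB.instance Definition _ := GRing.Zmodule.on alg_quot.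
HB.instance Definition _ := EqQuotient.on alg_quot.

Let Ileft a u : u \in I -> a * u \in I.
Proof. by case: (@tsideal_closed_subproof _ I) => _ _ + _; apply. Qed.

Let Iright a u : u \in I -> u * a \in I.
Proof. by case: (@tsideal_closed_subproof _ I) => _ _ _; apply. Qed.

Let Iscale (a : K) u : u \in I -> a *: u \in I.
Proof. by rewrite -[u in a *: u]mul1r scalerAl; apply: Ileft. Qed.

Let piI (x y : A) : x - y \in I -> \pi_alg_quot x = \pi_alg_quot y.
Proof. by move=> h; apply/eqP; rewrite piE. Qed.

Let reprI (x : A) : x - repr (\pi_alg_quot x) \in I.
Proof. by rewrite Quotient.idealrBE reprK. Qed.

Definition quot_one : alg_quot := \pi_alg_quot 1.
Definition quot_mul (x y : alg_quot) : alg_quot := \pi_alg_quot (repr x * repr y).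
Definition quot_scale (a : K) (x : alg_quot) : alg_quot := \pi_alg_quot (a *: repr x).

Fact quot_mulE (x y : A) : quot_mul (\pi x) (\pi y) = \pi_alg_quot (x * y).
Proof.
apply/esym/piI.
rewrite -[_ * _](addrNK (x * repr (\pi_alg_quot y))) -mulrBr -addrA -mulrBl.
by apply: rpredD; [apply: Ileft | apply: Iright]; apply: reprI.
Qed.

Fact quot_scaleE (a : K) (x : A) : quot_scale a (\pi x) = \pi_alg_quot (a *: x).
Proof. by apply/esym/piI; rewrite -scalerBr Iscale. Qed.

Fact quot_addE (x y : A) : \pi_alg_quot x + \pi_alg_quot y = \pi_alg_quot (x + y).
Proof. exact/esym/Quotient.pi_add. Qed.

Let lift1 (P : alg_quot -> Prop) : (forall x : A, P (\pi_alg_quot x)) -> forall x, P x.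
Proof. by move=> h x; rewrite -[x]reprK. Qed.

Fact quot_mulA : associative quot_mul.
Proof.
elim/lift1 => x; elim/lift1 => y; elim/lift1 => z.
by rewrite (quot_mulE y) (quot_mulE x) (quot_mulE x y) (quot_mulE _ z) mulrA.
Qed.

Fact quot_mul1l : left_id quot_one quot_mul.
Proof. by elim/lift1 => x; rewrite quot_mulE mul1r. Qed.

Fact quot_mul1r : right_id quot_one quot_mul.
Proof. by elim/lift1 => x; rewrite quot_mulE mulr1. Qed.

Fact quot_mulDl : left_distributive quot_mul +%R.
Proof.
elim/lift1 => x; elim/lift1 => y; elim/lift1 => z.
by rewrite (quot_addE x) (quot_mulE _ z) (quot_mulE x) (quot_mulE y) quot_addE mulrDl.
Qed.

Fact quot_mulDr : right_distributive quot_mul +%R.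
Proof.
elim/lift1 => x; elim/lift1 => y; elim/lift1 => z.
by rewrite (quot_addE y) (quot_mulE x) (quot_mulE x y) (quot_mulE x z) quot_addE mulrDr.
Qed.

HB.instance Definition _ := GRing.Zmodule_isPzRing.Build alg_quot
  quot_mulA quot_mul1l quot_mul1r quot_mulDl quot_mulDr.

Fact quot_scaleA (a b : K) x :
  quot_scale a (quot_scale b x) = quot_scale (a * b) x.
Proof.
elim/lift1: x => x.
by rewrite (quot_scaleE b) (quot_scaleE a) (quot_scaleE (a * b)) scalerA.
Qed.

Fact quot_scale1 : left_id 1 quot_scale.
Proof. by elim/lift1 => x; rewrite quot_scaleE scale1r. Qed.

Fact quot_scaleDr : right_distributive quot_scale +%R.
Proof.
move=> a; elim/lift1 => x; elim/lift1 => y.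
by rewrite (quot_addE x) (quot_scaleE a x) (quot_scaleE a y) quot_scaleE quot_addE scalerDr.
Qed.

Fact quot_scaleDl x : {morph quot_scale^~ x : a b / a + b}.
Proof.
by elim/lift1: x => x a b; rewrite (quot_scaleE a) (quot_scaleE b) (quot_scaleE (a + b)) quot_addE scalerDl.
Qed.

HB.instance Definition _ := GRing.Zmodule_isLmodule.Build K alg_quot
  quot_scaleA quot_scale1 quot_scaleDr quot_scaleDl.

Lemma quot_scalerAl (a : K) (u v : alg_quot) : a *: (u * v) = (a *: u) * v.
Proof.
elim/lift1: u => u; elim/lift1: v => v.
rewrite -[LHS]/(quot_scale a (quot_mul _ _)).
rewrite -[RHS]/(quot_mul (quot_scale a _) _).
by rewrite (quot_mulE u) (quot_scaleE a u) quot_scaleE quot_mulE scalerAl.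
Qed.

Lemma quot_scalerAr (a : K) (u v : alg_quot) : a *: (u * v) = u * (a *: v).
Proof.
elim/lift1: u => u; elim/lift1: v => v.
rewrite -[LHS]/(quot_scale a (quot_mul _ _)).
rewrite -[RHS]/(quot_mul _ (quot_scale a _)).
by rewrite (quot_mulE u) (quot_scaleE a v) quot_scaleE quot_mulE scalerAr.
Qed.
End QuotientAlgebra.

Section FreeAlgebra.
Variables (K : comNzRingType) (I : choiceType).

Definition free_alg : Type := {malg K[{fmonom I}]}.

HB.instance Definition _ := GRing.Lalgebra.on free_alg.

Fact free_alg_scalerAr (a : K) (u v : free_alg) : a *: (u * v) = u * (a *: v).
Proof.
rewrite [u * (a *: v)](malgMEw (fsubset_refl _) (msuppZ_le _ _)).
rewrite malgME scaler_sumr; apply/eq_bigr => k _.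
rewrite scaler_sumr; apply/eq_bigr => l _.
have UZ (c : K) p : a *: << c *g p >> = << a * c *g p >> :> {malg K[{fmonom I}]}.
  by apply/malgP => m; rewrite mcoeffU mcoeffZ mcoeffU -mulrnAr.
by rewrite UZ (mcoeffZ a v) mulrCA.
Qed.

HB.instance Definition _ :=
  GRing.LSemiAlgebra_isSemiAlgebra.Build K free_alg free_alg_scalerAr.

Definition free_gen (i : I) : free_alg := << fmu i >>.
End FreeAlgebra.

Section AlgebraA.
Variables (K : fieldType) (n d : nat) (mu q : K).

Definition algA_rel (r : free_alg K bool) : Prop :=
  let g := free_gen K true in
  let x := free_gen K false in
  [\/ r = g ^+ n - 1,
      r = x ^+ d - mu *: (1 - g ^+ d)
    | r = x * g - q *: (g * x)].

Definition algA : Type := alg_quot (ideal_gen algA_rel).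

HB.instance Definition _ := GRing.PzRing.on algA.
HB.instance Definition _ := GRing.Lmodule.on algA.
End AlgebraA.

Record quiver := Quiver {
  vertex : finType;
  arrow : finType;
  source : arrow -> vertex;
  target : arrow -> vertex;
  vertex_gt0 : (0 < #|vertex|)%N
}.

Section Paths.
Variable Q : quiver.

Fixpoint is_walk (v : vertex Q) (s : seq (arrow Q)) : bool :=
  if s is a :: s' then (source a == v) && is_walk (target a) s' else true.

Definition qpath : Type := {p : vertex Q * seq (arrow Q) | is_walk p.1 p.2}.
HB.instance Definition _ := Choice.on qpath.

Definition qstart (p : qpath) : vertex Q := (val p).1.
Definition qarrows (p : qpath) : seq (arrow Q) := (val p).2.
Definition qend (p : qpath) : vertex Q :=
  last (qstart p) (map (@target Q) (qarrows p)).

Definition vertex_path (v : vertex Q) : qpath :=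
  exist _ (v, [::]) isT.

Fact arrow_path_subproof (a : arrow Q) : is_walk (source a) [:: a].
Proof. by rewrite /= eqxx. Qed.

Definition arrow_path (a : arrow Q) : qpath :=
  exist _ (source a, [:: a]) (arrow_path_subproof a).

(* Composition is read from left to right: p followed by q.  The opposite      *)
(* convention gives the opposite path algebra, and the basic cycle is          *)
(* isomorphic to its opposite quiver.  The [insub] never fails when the        *)
(* endpoints match (qcompE).                                                   *)
Definition qcomp (p q : qpath) : option qpath :=
  if qend p == qstart q
  then (insub (qstart p, qarrows p ++ qarrows q) : option qpath) else None.

Lemma is_walk_cat v s1 s2 :
  is_walk v (s1 ++ s2) =
    is_walk v s1 && is_walk (last v (map (@target Q) s1)) s2.
Proof. by elim: s1 v => [|a s1 IHs] v //=; rewrite IHs andbA. Qed.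

Lemma qcompE p q : qend p = qstart q ->
  exists2 r, qcomp p q = Some r & val r = (qstart p, qarrows p ++ qarrows q).
Proof.
move=> epq; rewrite /qcomp epq eqxx; case: insubP => [r _ vr|]; first by exists r.
rewrite is_walk_cat (valP p) /= -[last _ _]/(qend p) epq.
by rewrite (valP q).
Qed.

Lemma qcomp_None p q : qend p != qstart q -> qcomp p q = None.
Proof. by rewrite /qcomp => /negPf->. Qed.

Lemma qcompA p q r :
  obind (fun s => qcomp s r) (qcomp p q) = obind (qcomp p) (qcomp q r).
Proof.
have [epq|npq] := eqVneq (qend p) (qstart q).
  have [s -> vs] := qcompE epq; rewrite /=.
  have ends : qend s = qend q.
    by rewrite /qend /qarrows /qstart vs /= map_cat last_cat; congr last.
  have [eqr|nqr] := eqVneq (qend q) (qstart r); last first.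
    by rewrite (qcomp_None nqr) qcomp_None // ends.
  have [t -> vt] := qcompE eqr; rewrite /=.
  have [u -> vu] := qcompE (etrans ends eqr).
  have ept : qend p = qstart t by rewrite epq /qstart vt.
  have [w -> vw] := qcompE ept.
  by congr Some; apply/val_inj; rewrite vu vw /qarrows /qstart vs vt /= catA.
rewrite qcomp_None //=.
have [eqr|nqr] := eqVneq (qend q) (qstart r); last by rewrite qcomp_None.
have [t -> vt] := qcompE eqr.
by rewrite /= qcomp_None // /qstart vt.
Qed.

Lemma qcomp1p v p :
  qcomp (vertex_path v) p = if v == qstart p then Some p else None.
Proof.
have [e|n] := eqVneq v (qstart p); last by rewrite qcomp_None.
have [|r -> vr] := @qcompE (vertex_path v) p; first exact: e.
by congr Some; apply/val_inj; rewrite vr -[qstart _]/v e -surjective_pairing.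
Qed.

Lemma qcompp1 p v :
  qcomp p (vertex_path v) = if v == qend p then Some p else None.
Proof.
have [e|n] := eqVneq v (qend p); last by rewrite qcomp_None // eq_sym.
have [|r -> vr] := @qcompE p (vertex_path v); first by rewrite -e.
by congr Some; apply/val_inj; rewrite vr cats0 -surjective_pairing.
Qed.
End Paths.

Section PathAlgebra.
Local Open Scope fset_scope.
Local Open Scope ring_scope.
Variables (K : comNzRingType) (Q : quiver).

Definition path_alg : Type := {malg K[qpath Q]}.
HB.instance Definition _ := GRing.Lmodule.on path_alg.

Implicit Types f g h : path_alg.

Definition path_elt (p : qpath Q) : path_alg := << p >>.

Definition oterm (c : K) (o : option (qpath Q)) : path_alg :=
  if o is Some p then << c *g p >> else 0.

Definition path_one : path_alg := \sum_v path_elt (vertex_path v).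

Definition path_mul f g : path_alg :=
  \sum_(p <- msupp f) \sum_(q <- msupp g) oterm (f@_p * g@_q) (qcomp p q).

Fact otermD c1 c2 o : oterm (c1 + c2) o = oterm c1 o + oterm c2 o.
Proof. by case: o => [p|] /=; rewrite ?monalgUD ?addr0. Qed.

Fact oterm0 o : oterm 0 o = 0.
Proof. by case: o => [p|] //=; rewrite monalgU0. Qed.

Fact otermZ a c o : a *: oterm c o = oterm (a * c) o.
Proof.
case: o => [p|] /=; last by rewrite scaler0.
by apply/malgP => k; rewrite mcoeffU mcoeffZ mcoeffU -mulrnAr.
Qed.

Fact path_mulEw (d1 d2 : {fset qpath Q}) f g :
  msupp f `<=` d1 -> msupp g `<=` d2 ->
  path_mul f g =
    \sum_(p <- d1) \sum_(q <- d2) oterm (f@_p * g@_q) (qcomp p q).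
Proof.
move=> le_d1 le_d2; rewrite /path_mul (big_fset_incl _ le_d1) /=.
  apply/eq_bigr=> p _; apply/big_fset_incl => // q _ /mcoeff_outdom ->.
  by rewrite mulr0 oterm0.
move=> p _ /mcoeff_outdom fp.
by rewrite big1 // => q _; rewrite fp mul0r oterm0.
Qed.

Fact path_mul0g : left_zero 0 path_mul.
Proof. by move=> g; rewrite /path_mul msupp0 big_seq_fset0. Qed.

Fact path_mulg0 : right_zero 0 path_mul.
Proof. by move=> g; rewrite /path_mul msupp0 big1 // => p _; rewrite big_seq_fset0. Qed.

Fact path_mulDl : left_distributive path_mul +%R.
Proof.
move=> f g h; pose d := msupp f `|` msupp g.
rewrite (@path_mulEw d (msupp h) (f + g)) ?msuppD_le //.
rewrite (@path_mulEw d (msupp h) f) ?fsubsetUl //.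
rewrite (@path_mulEw d (msupp h) g) ?fsubsetUr //.
rewrite -big_split; apply/eq_bigr => p _; rewrite -big_split.
by apply/eq_bigr => q _; rewrite mcoeffD mulrDl otermD.
Qed.

Fact path_mulDr : right_distributive path_mul +%R.
Proof.
move=> h f g; pose d := msupp f `|` msupp g.
rewrite (@path_mulEw (msupp h) d h (f + g)) ?msuppD_le //.
rewrite (@path_mulEw (msupp h) d h f) ?fsubsetUl //.
rewrite (@path_mulEw (msupp h) d h g) ?fsubsetUr //.
rewrite -big_split; apply/eq_bigr => p _; rewrite -big_split.
by apply/eq_bigr => q _; rewrite mcoeffD mulrDr otermD.
Qed.

Fact path_mulUU (a b : K) p q :
  path_mul << a *g p >> << b *g q >> = oterm (a * b) (qcomp p q).
Proof.
by rewrite (path_mulEw msuppU_le msuppU_le) !big_seq_fset1 !mcoeffUU.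
Qed.

Fact path_mul_suml (I : Type) (r : seq I) (F : I -> path_alg) g :
  path_mul (\sum_(i <- r) F i) g = \sum_(i <- r) path_mul (F i) g.
Proof.
exact: (big_morph (path_mul^~ g) (fun _ _ => path_mulDl _ _ _) (path_mul0g g)).
Qed.

Fact path_mul_sumr (I : Type) (r : seq I) (F : I -> path_alg) g :
  path_mul g (\sum_(i <- r) F i) = \sum_(i <- r) path_mul g (F i).
Proof.
exact: (big_morph (path_mul g) (fun _ _ => path_mulDr _ _ _) (path_mulg0 g)).
Qed.

(* An opaque copy of the basis terms, which keeps unification from unfolding   *)
(* them in the proofs below.                                                   *)
Fact path_basis : {U : K -> qpath Q -> path_alg |
  [/\ forall f, f = \sum_(p <- msupp f) U f@_p p,
      forall a b p q,
        path_mul (U a p) (U b q) = oapp (U (a * b)) 0 (qcomp p q)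
    & path_one = \sum_v U 1 (vertex_path v)]}.
Proof.
exists (fun a p => << a *g p >>); split=> // [f|a b p q]; first exact: monalgE.
by rewrite path_mulUU; case: qcomp.
Qed.

Fact path_mulA : associative path_mul.
Proof.
have [U [decomp mulU _]] := path_basis.
move=> f g h; rewrite [f]decomp 3!path_mul_suml; apply/eq_bigr => p _.
rewrite [g]decomp path_mul_suml 2!path_mul_sumr path_mul_suml.
apply/eq_bigr => q _.
rewrite [h]decomp 3!path_mul_sumr; apply/eq_bigr => r _.
rewrite (mulU _ _ p q) (mulU _ _ q r); have := qcompA p q r.
case: (qcomp p q) => [s|]; case: (qcomp q r) => [t|] /= E.
- by rewrite !mulU E mulrA.
- by rewrite mulU E path_mulg0.
- by rewrite mulU -E path_mul0g.
- by rewrite path_mulg0 path_mul0g.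
Qed.

Fact path_mul1g : left_id path_one path_mul.
Proof.
have [U [decomp mulU ->]] := path_basis.
move=> g; rewrite [g in LHS]decomp [RHS]decomp path_mul_sumr.
apply/eq_bigr => p _; rewrite path_mul_suml (bigD1 (qstart p)) //=.
rewrite mulU qcomp1p eqxx mul1r big1 ?addr0 // => v /negPf nv.
by rewrite mulU qcomp1p nv.
Qed.

Fact path_mulg1 : right_id path_one path_mul.
Proof.
have [U [decomp mulU ->]] := path_basis.
move=> g; rewrite [g in LHS]decomp [RHS]decomp path_mul_suml.
apply/eq_bigr => p _; rewrite path_mul_sumr (bigD1 (qend p)) //=.
rewrite mulU qcompp1 eqxx mulr1 big1 ?addr0 // => v /negPf nv.
by rewrite mulU qcompp1 nv.
Qed.

Fact path_one_neq0 : path_one != 0.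
Proof.
have [v _] := card_gt0P (vertex_gt0 Q).
have coef w : (path_elt (vertex_path w))@_(vertex_path v) = (w == v)%:R.
  rewrite mcoeffU; congr (_ *+ nat_of_bool _).
  by apply/eqP/eqP => [[]|->].
apply/eqP => /malgP/(_ (vertex_path v)); rewrite mcoeff0 raddf_sum.
rewrite (eq_bigr _ (fun w _ => coef w)) (bigD1 v) //= eqxx.
rewrite big1 => [|w /negPf->] //; rewrite addr0 => /eqP.
by rewrite oner_eq0.
Qed.

HB.instance Definition _ := GRing.Zmodule_isNzRing.Build path_alg
  path_mulA path_mul1g path_mulg1 path_mulDl path_mulDr path_one_neq0.

Fact path_scalerAl (a : K) f g : a *: (f * g) = (a *: f) * g.
Proof.
rewrite -[LHS]/(a *: path_mul f g) -[RHS]/(path_mul (a *: f) g).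
rewrite (path_mulEw (msuppZ_le _ _) (fsubset_refl _)) scaler_sumr.
apply/eq_bigr => p _; rewrite scaler_sumr; apply/eq_bigr => q _.
by rewrite otermZ mcoeffZ mulrA.
Qed.

Fact path_scalerAr (a : K) f g : a *: (f * g) = f * (a *: g).
Proof.
rewrite -[LHS]/(a *: path_mul f g) -[RHS]/(path_mul f (a *: g)).
rewrite (path_mulEw (fsubset_refl _) (msuppZ_le _ _)) scaler_sumr.
apply/eq_bigr => p _; rewrite scaler_sumr; apply/eq_bigr => q _.
by rewrite otermZ mcoeffZ mulrCA.
Qed.

HB.instance Definition _ :=
  GRing.Lmodule_isLalgebra.Build K path_alg path_scalerAl.
HB.instance Definition _ :=
  GRing.LSemiAlgebra_isSemiAlgebra.Build K path_alg path_scalerAr.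

Definition arrow_ideal : tsideal path_alg :=
  ideal_gen (fun f => exists a, f = path_elt (arrow_path a)).
End PathAlgebra.

Section BasicCycle.
Variables (d : nat) (d_gt0 : (0 < d)%N).

Fact basic_cycle_subproof : (0 < #|'I_d|)%N.
Proof. by rewrite card_ord. Qed.

(* The arrow i goes from i to ordS i, which is i + 1 modulo d. *)
Definition basic_cycle : quiver :=
  @Quiver 'I_d 'I_d id (@ordS d) basic_cycle_subproof.
End BasicCycle.

Definition truncated_cycle_alg (K : fieldType) (d : nat) (d_gt0 : (0 < d)%N) :
    Type :=
  alg_quot (ideal_pow (arrow_ideal K (basic_cycle d_gt0)) d).

HB.instance Definition _ K d d_gt0 :=
  GRing.PzRing.on (@truncated_cycle_alg K d d_gt0).
HB.instance Definition _ K d d_gt0 :=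
  GRing.Lmodule.on (@truncated_cycle_alg K d d_gt0).

(* The m-th roots of unity of an algebraic closure all lie in K exactly when   *)
(* X^m - 1 splits over K.                                                      *)
Definition contains_all_roots_of_unity (K : fieldType) : Prop :=
  forall m : nat, (0 < m)%N ->
    exists s : seq K, 'X^m - 1 = \prod_(z <- s) ('X - z%:P).

(* Main.v *)
Require Import Defs.
From HB Require Import structures.
From mathcomp Require Import all_boot all_order all_algebra.
From mathcomp Require Import finmap monalg boolp.
From mathcomp Require Import cyclic separable cyclotomic.

Set Implicit Arguments.
Unset Strict Implicit.
Unset Printing Implicit Defensive.

Import GRing.Theory.
Local Open Scope ring_scope.

(** Write A for A(n, d, mu, q). Since X^n - 1 has n distinct roots in K, the
    commutative subalgebra K[g] splits: for each n-th root of unity lam there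
    is an idempotent e_lam on which g acts as lam, and these idempotents sum
    to 1. The relation x g = q g x gives e_lam x = x e_(q lam), so x permutes
    the roots within each coset of the group generated by q. There
    are n / d cosets of d elements each; a coset is determined by the common
    value c of lam^d, and on it x^d = mu (1 - c) is a scalar w.

    The block of a coset is therefore an algebra with orthogonal idempotents
    eps_i, i in Z/d, summing to 1, a shift X with eps_i X = X eps_(i+1) and
    X^d = w, and basis eps_i X^j for i, j < d. Such an algebra is called here
    a weighted cycle of weight w ([weighted_cycle]). Two of them matter:
    - weight 0 is the truncated path algebra of the basic cycle
      ([truncated_weighted_cycle]); the paths of length less than d stay
      nonzero in the quotient because the d-th power of the arrow ideal lies
      in the span of the paths of length at least d;
    - nonzero weight w is the full matrix algebra, X being the companion
      matrix of X^d - w ([matrix_weighted_cycle]).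

    The weight mu (1 - c) vanishes for every coset when mu = 0, and only for
    the coset of 1 when mu is nonzero, which gives the two lists of factors.

    The isomorphism itself is obtained by bases ([block_decomposition]).
    The presentation of A gives one morphism f_s to each block; the
    elements e_lam x^j span A, and f_s sends them to the basis elements
    eps_i X^j of the block s when lam is in the coset s, and to 0 otherwise.
    Hence a family of elements, one in each block, comes from exactly one
    element of A. *)

(** * Evaluation of noncommutative polynomials *)

Section FreeAlgebraEvaluation.
Variables (K : comNzRingType) (I : choiceType) (B : algType K) (v : I -> B).

Definition word_prod (m : {fmonom I}) : B := \prod_(i <- fmonom_val m) v i.

Fact word_prod1 : word_prod mone = 1.
Proof. by rewrite /word_prod fm1 big_nil. Qed.

Fact word_prodM : {morph word_prod : m1 m2 / mmul m1 m2 >-> m1 * m2}.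
Proof. by move=> m1 m2; rewrite /word_prod fmM big_cat. Qed.

HB.instance Definition _ :=
  isMultiplicative.Build {fmonom I} B word_prod (word_prodM, word_prod1).

Definition free_eval (u : free_alg K I) : B := mmap (in_alg B) word_prod u.

Lemma free_eval_linear : linear free_eval.
Proof.
move=> a u w; rewrite /free_eval raddfD /= mmapZ; congr (_ + _).
by rewrite mulr_algl.
Qed.

Lemma free_eval_monoid_morphism : monoid_morphism free_eval.
Proof.
have [] // : multiplicative free_eval.
apply: commr_mmap_is_multiplicative => u m m'.
by rewrite /GRing.comm mulr_algl mulr_algr.
Qed.

HB.instance Definition _ := GRing.isLinear.Build K (free_alg K I) B _ free_eval
  free_eval_linear.
HB.instance Definition _ := GRing.isMonoidMorphism.Build (free_alg K I) B
  free_eval free_eval_monoid_morphism.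

Lemma free_eval_gen i : free_eval (free_gen K i) = v i.
Proof.
by rewrite /free_eval mmapU /= scale1r mul1r /word_prod fmU big_seq1.
Qed.
End FreeAlgebraEvaluation.

Lemma monalgUZ (R : nzRingType) (I : choiceType) (c : R) (m : I) :
  << c *g m >> = c *: << m >> :> {malg R[I]}.
Proof. by apply/malgP => k; rewrite mcoeffU mcoeffZ mcoeffU mulr_natr. Qed.

(** Words are built from 1 by multiplying generators on the right, and they
    span the free algebra. *)
Lemma free_alg_ind (K : comNzRingType) (I : choiceType)
    (P : free_alg K I -> Prop) :
    P 1 -> (forall a u w, P u -> P w -> P (a *: u + w)) ->
    (forall u i, P u -> P (u * free_gen K i)) ->
  forall u, P u.
Proof.
move=> P1 PZD PM u.
have P0 : P 0 by rewrite -(addNr 1) -scaleN1r; apply: PZD.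
have Pword s : P (<< FMonom s >> : {malg K[{fmonom I}]}).
  elim/last_ind: s => [|s i Ps].
    by rewrite -fmoneE; apply: P1.
  suff -> : (<< FMonom (rcons s i) >> : {malg K[{fmonom I}]}) =
            (<< FMonom s >> : free_alg K I) * free_gen K i by exact: PM.
  rewrite [RHS](malgMEw msuppU_le msuppU_le) !big_seq_fset1 !mcoeffUU mulr1.
  by congr << _ >>; apply: val_inj; rewrite /= fmM fmU cats1.
rewrite [u]monalgE.
elim: (enum_fset _) => [|m r IHr]; first by rewrite big_nil.
rewrite big_cons.
by rewrite monalgUZ; apply: PZD => //; rewrite -[m]fmK.
Qed.

(** * Quotients and the universal property of A(n, d, mu, q) *)

Section QuotientMap.
Variables (K : pzRingType) (A : algType K) (I : tsideal A).

Definition quot_map (u : A) : alg_quot I := \pi_(alg_quot I)%qT u.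

Fact quot_map_linear : linear quot_map.
Proof.
move=> a u v; rewrite /quot_map -quot_addE; congr (_ + _).
by rewrite -quot_scaleE.
Qed.

Fact quot_map_monoid_morphism : monoid_morphism quot_map.
Proof. by split=> // u v; rewrite /quot_map -quot_mulE. Qed.

HB.instance Definition _ :=
  GRing.isLinear.Build K A (alg_quot I) _ quot_map quot_map_linear.
HB.instance Definition _ :=
  GRing.isMonoidMorphism.Build A (alg_quot I) quot_map quot_map_monoid_morphism.

Lemma quot_map_eq0 u : (quot_map u == 0) = (u \in I).
Proof.
by rewrite -(raddf0 quot_map) -[u in RHS]subr0 Quotient.idealrBE.
Qed.

Lemma quot_map_repr (a : alg_quot I) : quot_map (repr a) = a.
Proof. exact: reprK. Qed.
End QuotientMap.

Section RelationImages.
Variables (K : fieldType) (F : algType K) (mu q : K) (d : nat) (g x : F).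

Lemma quot_map_power_rel (I : tsideal F) : g ^+ d - 1 \in I ->
  quot_map I g ^+ d = 1.
Proof.
rewrite -quot_map_eq0 raddfB /= rmorphXn rmorph1 subr_eq0.
by move=> /eqP.
Qed.

Lemma quot_map_nilpotency_rel (I : tsideal F) :
    x ^+ d - mu *: (1 - g ^+ d) \in I ->
  quot_map I x ^+ d = mu *: (1 - quot_map I g ^+ d).
Proof.
rewrite -quot_map_eq0 raddfB /= linearZ raddfB /= !rmorphXn rmorph1 subr_eq0.
by move=> /eqP.
Qed.

Lemma quot_map_commutation_rel (I : tsideal F) :
    x * g - q *: (g * x) \in I ->
  quot_map I x * quot_map I g = q *: (quot_map I g * quot_map I x).
Proof.
by rewrite -quot_map_eq0 raddfB /= linearZ /= !rmorphM subr_eq0 => /eqP.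
Qed.

Variables (B : algType K) (phi : {lrmorphism F -> B}).

Lemma lrmorph_power_rel : phi (g ^+ d - 1) = phi g ^+ d - 1.
Proof. by rewrite raddfB /= rmorphXn rmorph1. Qed.

Lemma lrmorph_nilpotency_rel :
  phi (x ^+ d - mu *: (1 - g ^+ d)) = phi x ^+ d - mu *: (1 - phi g ^+ d).
Proof. by rewrite raddfB /= linearZ /= raddfB /= !rmorphXn rmorph1. Qed.

Lemma lrmorph_commutation_rel :
  phi (x * g - q *: (g * x)) = phi x * phi g - q *: (phi g * phi x).
Proof. by rewrite raddfB /= linearZ /= !rmorphM. Qed.
End RelationImages.

Section AlgebraAUniversal.
Variables (K : fieldType) (n d : nat) (mu q : K).
Local Notation A := (algA n d mu q).

Definition algA_map : free_alg K bool -> A :=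
  quot_map (ideal_gen (algA_rel n d mu q)).
HB.instance Definition _ := GRing.Linear.on algA_map.
HB.instance Definition _ := GRing.RMorphism.on algA_map.

Definition algA_g : A := algA_map (free_gen K true).
Definition algA_x : A := algA_map (free_gen K false).

Lemma algA_scalerAl (c : K) (a b : A) : c *: (a * b) = (c *: a) * b.
Proof. exact: quot_scalerAl. Qed.

Lemma algA_scalerAr (c : K) (a b : A) : c *: (a * b) = a * (c *: b).
Proof. exact: quot_scalerAr. Qed.

Lemma algA_rel_ideal r :
  algA_rel n d mu q r -> r \in ideal_gen (algA_rel n d mu q).
Proof. by move=> Jr; apply/asboolP => T _; apply. Qed.

Lemma algA_gX : algA_g ^+ n = 1.
Proof. exact/quot_map_power_rel/algA_rel_ideal/Or31. Qed.

Lemma algA_xX : algA_x ^+ d = mu *: (1 - algA_g ^+ d).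
Proof. exact/quot_map_nilpotency_rel/algA_rel_ideal/Or32. Qed.

Lemma algA_xg : algA_x * algA_g = q *: (algA_g * algA_x).
Proof. exact/quot_map_commutation_rel/algA_rel_ideal/Or33. Qed.

(** The words in g and x span A, so a submodule that contains 1 and is stable
    under right multiplication by g and x is the whole of A. *)
Lemma algA_ind (P : A -> Prop) :
    P 1 -> (forall c a b, P a -> P b -> P (c *: a + b)) ->
    (forall a, P a -> P (a * algA_g)) -> (forall a, P a -> P (a * algA_x)) ->
  forall a, P a.
Proof.
move=> P1 PZD Pg Px a; rewrite -[a](quot_map_repr a) -[quot_map _]/algA_map.
elim/free_alg_ind: (repr _) => [|c u w Pu Pw|u [] Pu].
- by rewrite rmorph1.
- by rewrite linearP; apply: PZD.
- by rewrite rmorphM; apply: Pg.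
- by rewrite rmorphM; apply: Px.
Qed.

Section Evaluation.
Variables (B : algType K) (G X : B).
Hypotheses (GX : G ^+ n = 1) (XX : X ^+ d = mu *: (1 - G ^+ d))
  (XG : X * G = q *: (G * X)).

Local Notation ev := (free_eval (fun b : bool => if b then G else X)).

(** The choice of a representative is harmless: the kernel of the evaluation
    is a two-sided ideal containing the relations ([algA_eval_map]). *)
Definition algA_eval (a : A) : B := ev (repr a).

Lemma algA_eval_map u : algA_eval (algA_map u) = ev u.
Proof.
have /asboolP : repr (algA_map u) - u \in ideal_gen (algA_rel n d mu q).
  rewrite -quot_map_eq0 raddfB subr_eq0; apply/eqP; exact: quot_map_repr.
move=> /(_ (fun w => ev w = 0)) ker.
apply/eqP; rewrite -subr_eq0 -raddfB; apply/eqP; apply: ker.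
  split=> [|w z wK zK|w z zK|w z zK]; rewrite ?raddf0 //.
  - by rewrite raddfB /= wK zK subr0.
  - by rewrite rmorphM /= zK mulr0.
  - by rewrite rmorphM /= zK mul0r.
move=> r [] ->.
- by rewrite [LHS]lrmorph_power_rel /= free_eval_gen GX subrr.
- by rewrite [LHS]lrmorph_nilpotency_rel /= !free_eval_gen XX subrr.
- by rewrite [LHS]lrmorph_commutation_rel /= !free_eval_gen XG subrr.
Qed.

Lemma algA_eval_linear : linear algA_eval.
Proof.
move=> c a b; rewrite -[a](quot_map_repr a) -[b](quot_map_repr b).
rewrite -![quot_map _ _]/(algA_map _) -linearP !algA_eval_map.
exact: linearP.
Qed.

Lemma algA_eval_monoid_morphism : monoid_morphism algA_eval.
Proof.
split=> [|a b]; first by rewrite -(rmorph1 algA_map) algA_eval_map rmorph1.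
rewrite -[a](quot_map_repr a) -[b](quot_map_repr b).
by rewrite -![quot_map _ _]/(algA_map _) -rmorphM !algA_eval_map rmorphM.
Qed.

Lemma algA_eval_g : algA_eval algA_g = G.
Proof. by rewrite algA_eval_map [LHS]free_eval_gen. Qed.

Lemma algA_eval_x : algA_eval algA_x = X.
Proof. by rewrite algA_eval_map [LHS]free_eval_gen. Qed.
End Evaluation.
End AlgebraAUniversal.

(** * Weighted cycles *)

Section Span.
Variables (K : pzRingType) (V : lmodType K) (T : finType) (v : T -> V).

Definition spanned (a : V) : Prop := exists c : T -> K, a = \sum_t c t *: v t.

Lemma spannedZD c a b : spanned a -> spanned b -> spanned (c *: a + b).
Proof.
move=> [ca ->] [cb ->]; exists (fun t => c * ca t + cb t).
rewrite scaler_sumr -big_split; apply: eq_bigr => t _.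
by rewrite /= scalerA -scalerDl.
Qed.

Lemma spanned0 : spanned 0.
Proof. by exists (fun _ => 0); rewrite big1 // => t _; rewrite scale0r. Qed.

Lemma spanned_gen t : spanned (v t).
Proof.
exists (fun u => (u == t)%:R); rewrite (bigD1 t) //= eqxx scale1r.
by rewrite big1 ?addr0 // => u /negPf->; rewrite scale0r.
Qed.

Lemma spannedZ c a : spanned a -> spanned (c *: a).
Proof.
by move=> Sa; rewrite -[_ *: _]addr0; apply: spannedZD => //; apply: spanned0.
Qed.

Lemma spanned_sum (J : Type) (r : seq J) (F : J -> V) :
  (forall j, spanned (F j)) -> spanned (\sum_(j <- r) F j).
Proof.
move=> SF; elim: r => [|j r IHr]; first by rewrite big_nil; apply: spanned0.
by rewrite big_cons -[F j]scale1r; apply: spannedZD.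
Qed.
End Span.

(** The condition [wc_neq0] on the longest monomials eps_i X^(d-1) alone makes
    all the monomials linearly independent ([wc_free]), so that, with
    [wc_span], they form a basis. *)
Record weighted_cycle (K : fieldType) (d : nat) (B : algType K) (w : K) :=
  WeightedCycle {
    wc_idem : 'I_d -> B;
    wc_shift : B;
    wc_orth : forall i j,
      wc_idem i * wc_idem j = if i == j then wc_idem i else 0;
    wc_sum : \sum_i wc_idem i = 1;
    wc_comm : forall i, wc_idem i * wc_shift = wc_shift * wc_idem (ordS i);
    wc_pow : wc_shift ^+ d = w%:A;
    wc_neq0 : forall i, wc_idem i * wc_shift ^+ d.-1 != 0;
    wc_span : forall b,
      spanned (fun t : 'I_d * 'I_d => wc_idem t.1 * wc_shift ^+ t.2) b
  }.

Lemma ordS_inj m : injective (@ordS m).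
Proof. exact: (can_inj (@ordSK m)). Qed.

Lemma iter_ordS_inj d (i j k : 'I_d) :
  iter j (@ordS d) i = iter k (@ordS d) i -> j = k.
Proof.
have val_iter m : val (iter m (@ordS d) i) = ((i + m) %% d)%N.
  elim: m => [|m IHm] /=; first by rewrite addn0 modn_small.
  by rewrite IHm -addn1 modnDml addn1 addnS.
move/(congr1 val)/eqP; rewrite !val_iter eqn_modDl => /eqP.
by rewrite !modn_small // => /val_inj.
Qed.

Lemma shift_commX (R : pzRingType) (T : Type) (eps : T -> R) (x : R)
    (sigma : T -> T) :
    (forall i, eps i * x = x * eps (sigma i)) ->
  forall i k, eps i * x ^+ k = x ^+ k * eps (iter k sigma i).
Proof.
move=> comm i k; elim: k i => [|k IHk] i; first by rewrite mulr1 mul1r.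
by rewrite exprS mulrA comm -mulrA IHk mulrA iterSr.
Qed.

Section WeightedCycle.
Variables (K : fieldType) (d : nat) (B : algType K) (w : K).
Variable C : weighted_cycle d B w.
Local Notation eps := (wc_idem C).
Local Notation X := (wc_shift C).

Lemma wc_commX i k : eps i * X ^+ k = X ^+ k * eps (iter k (@ordS d) i).
Proof. exact: shift_commX (wc_comm C) i k. Qed.

Lemma wc_monomial_neq0 (i j : 'I_d) : eps i * X ^+ j != 0.
Proof.
apply: contra_neq (wc_neq0 C i) => e0.
have le_jd : (j <= d.-1)%N by rewrite -ltnS (ltn_predK (ltn_ord i)).
by rewrite -(subnKC le_jd) exprD mulrA e0 mul0r.
Qed.

(** Multiplying by eps_i on the left and by eps_(i+k) on the right kills every
    monomial except eps_i X^k, and so isolates one coefficient. *)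
Lemma wc_free (c : 'I_d * 'I_d -> K) :
  \sum_t c t *: (eps t.1 * X ^+ t.2) = 0 -> forall t, c t = 0.
Proof.
move=> c0 [i k].
have {}c0 : \sum_i \sum_j c (i, j) *: (eps i * X ^+ j) = 0.
  by rewrite pair_bigA -[RHS]c0; apply: eq_bigr => -[].
have: eps i * 0 * eps (iter k (@ordS d) i) = 0.
  by rewrite mulr0 mul0r.
rewrite -{1}c0 mulr_sumr mulr_suml (@big_only1 _ _ _ _ i) // => [|i' ne_i _].
  rewrite mulr_sumr mulr_suml (@big_only1 _ _ _ _ k) // => [|j ne_j _].
    rewrite -scalerAr -scalerAl mulrA wc_orth eqxx wc_commX -mulrA wc_orth.
    rewrite eqxx -wc_commX => /eqP; rewrite scaler_eq0 => /orP[/eqP //|].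
    by rewrite (negPf (wc_monomial_neq0 i k)).
  rewrite -scalerAr -scalerAl mulrA wc_orth eqxx wc_commX -mulrA wc_orth.
  case: eqP => [/iter_ordS_inj jk|_]; last by rewrite mulr0 scaler0.
  by rewrite jk eqxx in ne_j.
rewrite mulr_sumr mulr_suml big1 // => j _.
by rewrite -scalerAr mulrA wc_orth eq_sym (negPf ne_i) mul0r scaler0 mul0r.
Qed.

End WeightedCycle.

(** * Matrix algebras are weighted cycles of nonzero weight *)

Lemma char_poly_castmx (R : comNzRingType) m k (e : m = k) (M : 'M[R]_m) :
  char_poly (castmx (e, e) M) = char_poly M.
Proof. by case: _ / e; rewrite castmx_id. Qed.

Section MatrixCycle.
Variables (K : fieldType) (d' : nat) (w : K).
Local Notation d := d'.+1.

(* The cyclic shift with a single entry w, in the last row. *)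
Let X : 'M[K]_d :=
  \matrix_(i, j) if j == ordS i then if i == ord_max then w else 1 else 0.

(** The shift is the companion matrix of X^d - w, so Cayley-Hamilton applies. *)
Lemma matrix_shiftX : X ^+ d = w%:A.
Proof.
pose p : {poly K} := 'X^d - w%:P.
have sz : size p = d.+1 by rewrite size_XnsubC.
have pd : (size p).-1 = d by rewrite sz.
have Xp : X = castmx (pd, pd) (companionmx p).
  apply/matrixP => i j; rewrite castmxE !mxE /= sz /=.
  have -> : (i == d' :> nat) = (i == ord_max) by [].
  rewrite -[j == _]val_eqE /=; case: (eqVneq i ord_max) => [->|ne_i] /=.
    rewrite modnn /p coefB coefXn coefC (ltn_eqF (ltn_ord j)).
    by case: eqP => _; rewrite /= sub0r ?opprK ?oppr0.
  rewrite modn_small; first by rewrite eq_sym; case: eqP.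
  by rewrite ltnS ltn_neqAle -ltnS ltn_ord andbT; apply: ne_i.
have := Cayley_Hamilton X; rewrite Xp.
have -> : char_poly (castmx (pd, pd) (companionmx p)) = p.
  by rewrite char_poly_castmx companionmxK ?monicXnsubC.
rewrite -Xp rmorphB /= rmorphXn /= horner_mx_X horner_mx_C => /eqP.
by rewrite subr_eq0 scalemx1 => /eqP.
Qed.

Let eps (i : 'I_d) : 'M[K]_d := delta_mx i i.

Lemma delta_mx_sandwich (i k : 'I_d) (M : 'M[K]_d) :
  delta_mx i i * M * delta_mx k k = M i k *: delta_mx i k.
Proof.
apply/matrixP => a b; rewrite !mxE (@big_only1 _ _ _ _ k) // => [|l ne_l _].
  rewrite !mxE (@big_only1 _ _ _ _ i) // => [|l ne_l _].
    rewrite !mxE !eqxx andbT.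
    by case: eqP => _; case: eqP => _; rewrite !(mulr1, mulr0, mul1r, mul0r).
  by rewrite mxE (negPf ne_l) andbF mul0r.
by rewrite [delta_mx k k l b]mxE (negPf ne_l) mulr0.
Qed.

(** A nonzero weight makes the shift invertible, so no eps_i X^k vanishes. As
    eps_i X^k = eps_i X^k eps_(i+k) has only the entry (i, i + k), it is a
    nonzero multiple of that matrix unit, and every matrix unit arises so. *)
Lemma matrix_weighted_cycle : w != 0 -> weighted_cycle d 'M[K]_d w.
Proof.
move=> w0.
have orth i j : eps i * eps j = if i == j then eps i else 0.
  by rewrite /eps -[_ * _]/(_ *m _) mul_delta_mx_cond; case: eqP => [->|].
have comm i : eps i * X = X * eps (ordS i).
  apply/matrixP => a b; rewrite !mxE.
  rewrite (@big_only1 _ _ _ _ i) // => [|l ne_l _]; last first.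
    by rewrite mxE (negPf ne_l) andbF mul0r.
  rewrite (@big_only1 _ _ _ _ (ordS i)) // => [|l ne_l _]; last first.
    by rewrite [delta_mx _ _ l b]mxE (negPf ne_l) mulr0.
  rewrite !mxE !eqxx andbT (inj_eq (@ordS_inj _)) [i == a]eq_sym.
  case: (eqVneq a i) => [->|_]; rewrite ?mul1r ?mul0r //.
  by case: eqP; rewrite ?mulr1 ?mulr0.
have commX := shift_commX comm.
have neq0 (i : 'I_d) k : (k <= d)%N -> eps i * X ^+ k != 0.
  move=> le_kd; apply: contra_neq w0 => e0.
  have : eps i * X ^+ (k + (d - k)) = 0 by rewrite exprD mulrA e0 mul0r.
  rewrite subnKC // matrix_shiftX mulr_algr => /matrixP/(_ i i).
  by rewrite !mxE eqxx mulr1.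
have entry i k (l := iter k (@ordS d) i) :
    eps i * X ^+ k = (X ^+ k) i l *: delta_mx i l.
  by rewrite -delta_mx_sandwich -[delta_mx i i]/(eps i) commX -mulrA orth eqxx.
apply: (@WeightedCycle _ _ _ _ eps X) => //.
- exact/esym/mx1_sum_delta.
- exact: matrix_shiftX.
- by move=> i; apply: neq0.
have entry_neq0 (i j : 'I_d) : (X ^+ j) i (iter j (@ordS d) i) != 0.
  apply: contra_neq (neq0 i j (ltnW (ltn_ord j))) => e0.
  by rewrite entry e0 scale0r.
move=> b.
pose sigma (i j : 'I_d) := iter j (@ordS d) i.
exists (fun t => b t.1 (sigma t.1 t.2) / (X ^+ t.2) t.1 (sigma t.1 t.2)).
rewrite {1}[b]matrix_sum_delta.
rewrite -(pair_bigA _ (fun i j =>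
  (b i (sigma i j) / (X ^+ j) i (sigma i j)) *: (eps i * X ^+ j))) /=.
apply: eq_bigr => i _.
have inj_i : injective (sigma i).
  by move=> j k /iter_ordS_inj.
rewrite (reindex_inj inj_i); apply: eq_bigr => j _.
by rewrite entry scalerA divfK.
Qed.
End MatrixCycle.

(** * The truncated cycle algebra is the weighted cycle of weight zero *)

Section LengthFiltration.
Variables (K : comNzRingType) (Q : quiver).
Local Notation PA := (path_alg K Q).
Implicit Types (f g : PA) (p : qpath Q).

(** The span of the paths of length at least k, described by coefficients. *)
Definition length_ge (k : nat) (f : PA) : Prop :=
  forall p, (size (qarrows p) < k)%N -> (f : {malg K[qpath Q]})@_p = 0.

Lemma length_geM k l f g :
  length_ge k f -> length_ge l g -> length_ge (k + l) (f * g).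
Proof.
move=> fk gl r r_small; rewrite -[f * g]/(path_mul f g) /path_mul.
rewrite raddf_sum big1 // => p _; rewrite raddf_sum big1 // => s _.
have [epq|npq] := eqVneq (qend p) (qstart s); last first.
  by rewrite qcomp_None //= mcoeff0.
have [t -> vt] := qcompE epq; rewrite /= mcoeffU.
case: eqP => [tr|_] //; rewrite mulr1n.
have size_r : size (qarrows r) = (size (qarrows p) + size (qarrows s))%N.
  by rewrite -tr /qarrows vt size_cat.
have [/fk->|le_kp] := ltnP (size (qarrows p)) k; first by rewrite mul0r.
rewrite gl ?mulr0 // -(ltn_add2l k); apply: leq_ltn_trans r_small.
by rewrite size_r leq_add2r.
Qed.

Lemma length_ge_closed k : tsideal_closed (length_ge k).
Proof.
split=> [p _|f g fk gk p lt_pk|f g gk|f g gk]; first exact: mcoeff0.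
- by rewrite mcoeffB fk // gk // subr0.
- by rewrite -[k]add0n; apply: length_geM.
- by rewrite -[k]addn0; apply: length_geM.
Qed.

Lemma arrow_ideal_length f : f \in arrow_ideal K Q -> length_ge 1 f.
Proof.
move=> /asboolP; apply=> [|_ [a ->]]; first exact: length_ge_closed.
move=> p; rewrite ltnS leqn0 => /nilP p0.
rewrite mcoeffU; case: eqP => [ap|//].
by move: p0; rewrite -ap.
Qed.

Lemma arrow_ideal_pow_length k f :
  f \in ideal_pow (arrow_ideal K Q) k -> length_ge k f.
Proof.
move=> /asboolP; apply=> [|_ [s [Js ->]]]; first exact: length_ge_closed.
elim: k s Js => [|k IHk] s Js; first by [].
rewrite big_ord_recl; apply: (@length_geM 1 k); first exact: arrow_ideal_length.
have := IHk [tuple of behead s].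
have tb i : tnth [tuple of behead s] i = tnth s (lift ord0 i).
  by rewrite (tnth_nth 0) (tnth_nth 0) nth_behead.
under eq_bigr do rewrite tb; apply=> i; first by rewrite tb; apply: Js.
Qed.
End LengthFiltration.

Lemma mul_expr_chain (R : pzRingType) (P : nat -> R) (x : R) :
  (forall k, P k * x = P k.+1) -> forall k, P 0 * x ^+ k = P k.
Proof.
by move=> Px; elim=> [|k IHk]; rewrite ?mulr1 // exprSr mulrA IHk Px.
Qed.

Lemma spanned_nilpotent (K : fieldType) (B : algType K) (d : nat)
    (eps : 'I_d -> B) (x : B) (i : 'I_d) k :
    x ^+ d = 0 ->
  spanned (fun t : 'I_d * 'I_d => eps t.1 * x ^+ t.2) (eps i * x ^+ k).
Proof.
move=> xd0; have [lt_kd|le_dk] := ltnP k d.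
  exact: (spanned_gen _ (i, Ordinal lt_kd)).
by rewrite -(subnKC le_dk) exprD xd0 mul0r mulr0; apply: spanned0.
Qed.

Section CyclePaths.
Variables (K : fieldType) (d : nat) (d_gt0 : (0 < d)%N).
Local Notation Q := (basic_cycle d_gt0).
Local Notation PA := (path_alg K Q).

Fact cycle_walk (i : 'I_d) k : @is_walk Q i (traject (@ordS d) i k).
Proof. by elim: k i => //= k IHk i; rewrite eqxx IHk. Qed.

Definition cycle_path (i : 'I_d) (k : nat) : qpath Q :=
  exist _ (i, traject (@ordS d) i k) (cycle_walk i k).

(** A vertex of the basic cycle has a single outgoing arrow, so a path is
    determined by its origin and its length. *)
Lemma cycle_pathE (p : qpath Q) :
  p = cycle_path (qstart p) (size (qarrows p)).
Proof.
case: p => -[i s] ws; apply: val_inj; rewrite /= /qstart /qarrows /=.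
congr pair; elim: s i ws => //= a s IHs i /andP[/eqP <- ws].
by congr cons; apply: IHs.
Qed.

Lemma cycle_path_end i k : qend (cycle_path i k) = iter k (@ordS d) i.
Proof.
rewrite /qend /qarrows /qstart /=.
by elim: k i => //= k IHk i; rewrite IHk -iterSr.
Qed.

Lemma path_eltM (p q : qpath Q) :
  path_elt K p * path_elt K q = oterm 1 (qcomp p q) :> PA.
Proof. by rewrite -[LHS]/(path_mul _ _) path_mulUU mulr1. Qed.

Definition cycle_arrows : PA := \sum_(a : 'I_d) path_elt K (@arrow_path Q a).

Lemma cycle_path_arrows i k :
  path_elt K (cycle_path i k) * cycle_arrows = path_elt K (cycle_path i k.+1).
Proof.
rewrite mulr_sumr (@big_only1 _ _ _ _ (iter k (@ordS d) i)) // => [|a ne_a _].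
  have [|r e vr] :=
    @qcompE _ (cycle_path i k) (@arrow_path Q (iter k (@ordS d) i)).
    exact: cycle_path_end.
  rewrite path_eltM e /=; congr << _ >>; apply: val_inj; rewrite vr /=.
  by congr pair; rewrite cats1 -trajectSr.
by rewrite path_eltM qcomp_None // cycle_path_end eq_sym.
Qed.

Lemma vertex_arrowsX (i : 'I_d) k :
  path_elt K (@vertex_path Q i) * cycle_arrows ^+ k =
    path_elt K (cycle_path i k).
Proof.
have -> : @vertex_path Q i = cycle_path i 0 by apply: val_inj.
exact: (mul_expr_chain (cycle_path_arrows i)).
Qed.

Lemma arrows_vertex (i : 'I_d) :
  cycle_arrows * path_elt K (@vertex_path Q (ordS i)) =
    path_elt K (cycle_path i 1).
Proof.
rewrite mulr_suml (@big_only1 _ _ _ _ i) // => [|a ne_a _].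
  rewrite path_eltM qcompp1 eqxx /=; congr << _ >>; exact: val_inj.
rewrite path_eltM qcompp1; case: eqP => // /esym/ordS_inj e.
by rewrite e eqxx in ne_a.
Qed.

Local Notation T := (truncated_cycle_alg K d_gt0).
Local Notation J := (arrow_ideal K Q).

Definition trunc_map : PA -> T := quot_map (ideal_pow J d).
HB.instance Definition _ := GRing.Linear.on trunc_map.
HB.instance Definition _ := GRing.RMorphism.on trunc_map.

Lemma trunc_arrowsX : trunc_map cycle_arrows ^+ d = 0.
Proof.
rewrite -rmorphXn; apply/eqP; rewrite -[_ == _]/(quot_map _ _ == 0).
rewrite quot_map_eq0; apply/asboolP => S _; apply.
exists (nseq_tuple d cycle_arrows); split=> [i|].
  rewrite tnth_nseq; apply: rpred_sum => a _.
  by apply/asboolP => S' _; apply; exists a.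
by under eq_bigr do rewrite tnth_nseq; rewrite prodr_const card_ord.
Qed.

(** Elements of J^d have no component on a path shorter than d. *)
Lemma trunc_path_neq0 i k :
  (k < d)%N -> trunc_map (path_elt K (cycle_path i k)) != 0.
Proof.
move=> lt_kd; rewrite -[_ == _]/(quot_map _ _ == 0) quot_map_eq0.
apply/negP => /arrow_ideal_pow_length/(_ (cycle_path i k)).
rewrite mcoeffUU /qarrows /= size_traject => /(_ lt_kd)/eqP.
by rewrite oner_eq0.
Qed.

Fact trunc_one_neq0 : 1 != 0 :> T.
Proof.
apply/eqP => one0; have := trunc_path_neq0 (Ordinal d_gt0) d_gt0.
by rewrite -[trunc_map _]mul1r one0 mul0r eqxx.
Qed.

HB.instance Definition _ := GRing.PzSemiRing_isNonZero.Build T trunc_one_neq0.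
HB.instance Definition _ :=
  GRing.Lmodule_isLalgebra.Build K T (@quot_scalerAl _ _ _).
HB.instance Definition _ :=
  GRing.LSemiAlgebra_isSemiAlgebra.Build K T (@quot_scalerAr _ _ _).

(** With the trivial paths as idempotents and the sum of all arrows as shift,
    the monomial eps_i X^k is the path of length k that starts at i; this
    vanishes in the quotient when k is at least d, as X^d does. *)
Lemma truncated_weighted_cycle : weighted_cycle d T 0.
Proof.
pose eps (i : 'I_d) := trunc_map (path_elt K (@vertex_path Q i)).
pose X := trunc_map cycle_arrows.
have epsX i k : eps i * X ^+ k = trunc_map (path_elt K (cycle_path i k)).
  by rewrite -rmorphXn -rmorphM vertex_arrowsX.
apply: (@WeightedCycle _ _ _ _ eps X).
- move=> i j; rewrite -rmorphM path_eltM qcompp1 eq_sym.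
  by rewrite -[qend _]/i; case: eqP => [->|_] //; rewrite raddf0.
- by rewrite -raddf_sum; apply: rmorph1.
- by move=> i; rewrite -[X]expr1 epsX expr1 -rmorphM arrows_vertex.
- by rewrite trunc_arrowsX scale0r.
- by move=> i; rewrite epsX trunc_path_neq0 // prednK.
move=> b; rewrite -[b](quot_map_repr b) -[quot_map _]/trunc_map.
have mapU c p : trunc_map << c *g p >> = c *: trunc_map (path_elt K p).
  by rewrite monalgUZ; apply: (linearZ_LR trunc_map).
rewrite [repr b]monalgE raddf_sum; apply: spanned_sum => p.
rewrite [X in spanned _ X]mapU; apply: spannedZ; rewrite [p]cycle_pathE -epsX.
exact: (spanned_nilpotent eps _ _ trunc_arrowsX).
Qed.
End CyclePaths.

(** * Roots of unity and idempotents *)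

Lemma linear_combination_map (K : pzRingType) (V W : lmodType K) (f : V -> W)
    (T : finType) (c : T -> K) (v : T -> V) :
  linear f -> f (\sum_t c t *: v t) = \sum_t c t *: f (v t).
Proof.
move=> lf; have f0 : f 0 = 0.
  by have := lf (-1) 0 0; rewrite !scaleN1r !addNr.
by elim/big_rec2: _ => // t y z _ <-; rewrite lf.
Qed.

Lemma exists_primitive_root (K : fieldType) (n : nat) :
    [pchar K] =i pred0 -> contains_all_roots_of_unity K -> (0 < n)%N ->
  exists z : K, n.-primitive_root z.
Proof.
move=> charK rootsK n_gt0; have [s Ds] := rootsK n n_gt0.
have nK : n%:R != 0 :> K by rewrite (iffLR (pcharf0P K) charK) -lt0n.
have uniq_s : uniq s.
  rewrite -separable_prod_XsubC -Ds; exact: separable_Xn_sub_1.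
have size_s : (n <= size s)%N.
  by rewrite -ltnS -(size_prod_XsubC s id) -Ds size_XnsubC.
have unity_s : all n.-unity_root s.
  by apply/allP => z; rewrite -root_prod_XsubC -Ds.
by have [z _ pz] := hasP (has_prim_root n_gt0 unity_s uniq_s size_s); exists z.
Qed.

Section IdempotentCombination.
Variables (K : fieldType) (B : algType K) (T : finType) (eps : T -> B).
Hypotheses (orth : forall i j, eps i * eps j = if i == j then eps i else 0)
  (sum1 : \sum_i eps i = 1).

Lemma idem_combM (a b : T -> K) :
  (\sum_i a i *: eps i) * (\sum_i b i *: eps i) = \sum_i (a i * b i) *: eps i.
Proof.
rewrite mulr_suml; apply: eq_bigr => i _.
rewrite mulr_sumr (@big_only1 _ _ _ _ i) // => [|j ne_j _].
  by rewrite -scalerAl -scalerAr orth eqxx scalerA.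
by rewrite -scalerAl -scalerAr orth eq_sym (negPf ne_j) !scaler0.
Qed.

Lemma idem_combX (a : T -> K) k :
  (\sum_i a i *: eps i) ^+ k = \sum_i (a i ^+ k) *: eps i.
Proof.
elim: k => [|k IHk].
  by rewrite expr0 -sum1; apply: eq_bigr => i _; rewrite scale1r.
by rewrite exprS IHk idem_combM; apply: eq_bigr => i _; rewrite exprS.
Qed.

Lemma idem_comb_const c : \sum_i c *: eps i = c%:A.
Proof. by rewrite -scaler_sumr sum1. Qed.
End IdempotentCombination.

(** * The block decomposition *)

(* The set S indexes the cosets of the group generated by q among the n-th
    roots of unity, and r chooses a root in each coset: distinct cosets are
    told apart by the d-th power of their elements. *)
Section Blocks.
Variables (K : fieldType) (n d : nat) (mu q : K) (S : finType) (r : S -> K).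
Hypotheses (n_gt0 : (0 < n)%N) (nK : n%:R != 0 :> K)
  (q_prim : d.-primitive_root q) (cardS : (#|S| * d)%N = n)
  (rn : forall s, r s ^+ n = 1) (r_inj : injective (fun s => r s ^+ d)).

Let lam (t : S * 'I_d) : K := r t.1 * q ^+ t.2.

Let lamn t : lam t ^+ n = 1.
Proof.
rewrite exprMn rn mul1r -exprM -[in LHS]cardS mulnA mulnC exprM.
by rewrite (prim_expr_order q_prim) expr1n.
Qed.

Let lam0 t : lam t != 0.
Proof.
apply/eqP => t0; have := lamn t; rewrite t0 expr0n gtn_eqF // => /esym/eqP.
by rewrite oner_eq0.
Qed.

Let lam_inj : injective lam.
Proof.
move=> [s i] [s' i'] e; have es : s = s'.
  apply: r_inj; have := congr1 (fun z => z ^+ d) e.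
  rewrite /lam !exprMn -!exprM ![(_ * d)%N]mulnC !exprM.
  by rewrite (prim_expr_order q_prim) !expr1n !mulr1.
move: e; rewrite -es => /mulfI.
have rs0 : r s != 0.
  by have := lam0 (s, i); rewrite mulf_eq0 negb_or => /andP[].
move=> /(_ rs0)/eqP; rewrite (eq_prim_root_expr q_prim) !modn_small //.
by move=> /eqP/val_inj /= ->.
Qed.

(* The coefficient of g^k in the idempotent of the root lam t. *)
Let coef (t : S * 'I_d) k : K := n%:R^-1 * lam t ^- k.

Let coef_orth t u : \sum_(k < n) coef t k * lam u ^+ k = (t == u)%:R.
Proof.
have -> : \sum_(k < n) coef t k * lam u ^+ k =
    n%:R^-1 * \sum_(k < n) (lam u / lam t) ^+ k.
  rewrite mulr_sumr; apply: eq_bigr => k _.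
  by rewrite /coef -mulrA expr_div_n [lam u ^+ k / _]mulrC.
case: eqVneq => [->|ne_tu].
  under eq_bigr do rewrite divff // expr1n.
  by rewrite sumr_const card_ord mulVf.
have ne1 : lam u / lam t - 1 != 0.
  rewrite subr_eq0; apply: contra_neq ne_tu => e1.
  by apply: lam_inj; rewrite -[lam u](divfK (lam0 t)) e1 mul1r.
(* A geometric sum of ratio z != 1 vanishes when z ^ n = 1. *)
apply/eqP; rewrite mulf_eq0 -[X in _ || X](mulrI_eq0 _ (mulfI ne1)).
by rewrite -subrX1 expr_div_n !lamn divr1 subrr eqxx orbT.
Qed.

Let coef_sum k : (k < n)%N -> \sum_t coef t k = (k == 0)%:R.
Proof.
(* The dual orthogonality relation: the polynomials with these coefficients are
   the Lagrange interpolators at the n roots, so their sum takes the value 1 at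
   n points while having degree less than n. *)
pose p : {poly K} := \sum_t \poly_(j < n) coef t j - 1.
have p0 : p = 0.
  apply/eqP; apply/negPn/negP => p_neq0.
  have := max_poly_roots p_neq0 (rs := [seq lam u | u : S * 'I_d]).
  rewrite map_inj_uniq ?enum_uniq // size_map -cardE card_prod card_ord cardS.
  have -> : all (root p) [seq lam u | u : S * 'I_d].
    apply/allP => _ /mapP[u _ ->]; rewrite /root hornerD hornerN hornerC.
    rewrite horner_sum (bigD1 u) //= horner_poly coef_orth eqxx.
    rewrite big1 ?addr0 ?subrr // => t ne_tu.
    by rewrite horner_poly coef_orth (negPf ne_tu).
  move=> /(_ isT isT); rewrite ltnNge => /negP[].
  rewrite (leq_trans (size_polyD _ _)) // geq_max size_polyN size_poly1 n_gt0.
  rewrite andbT; apply: (leq_trans (size_sum _ _ _)); apply/bigmax_leqP => t _.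
  exact: size_poly.
move=> lt_kn; have := congr1 (fun p : {poly K} => p`_k) p0.
rewrite coef0 coefB coef1 coef_sum => /eqP; rewrite subr_eq0 => /eqP <-.
by apply: eq_bigr => t _; rewrite coef_poly lt_kn.
Qed.

Variables (B : S -> algType K).
Variable C : forall s, weighted_cycle d (B s) (mu * (1 - r s ^+ d)).

(** The image of g in the block s: the i-th idempotent of the block carries the
    eigenvalue r s q^i. *)
Definition diag_elt s : B s := \sum_i lam (s, i) *: wc_idem (C s) i.

Let diag_eltX s k : diag_elt s ^+ k = \sum_i lam (s, i) ^+ k *: wc_idem (C s) i.
Proof. exact: idem_combX (wc_orth (C s)) (wc_sum (C s)) _ _. Qed.

Lemma diag_elt_order s : diag_elt s ^+ n = 1.
Proof.
rewrite diag_eltX -(wc_sum (C s)).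
by apply: eq_bigr => i _; rewrite lamn scale1r.
Qed.

Lemma diag_elt_shiftX s : wc_shift (C s) ^+ d = mu *: (1 - diag_elt s ^+ d).
Proof.
have -> : diag_elt s ^+ d = (r s ^+ d)%:A.
  rewrite diag_eltX -(idem_comb_const (wc_sum (C s))); apply: eq_bigr => i _.
  rewrite /lam exprMn -exprM mulnC exprM.
  by rewrite (prim_expr_order q_prim) expr1n mulr1.
by rewrite wc_pow -scalerA scalerBl scale1r.
Qed.

Lemma diag_elt_comm s :
  wc_shift (C s) * diag_elt s = q *: (diag_elt s * wc_shift (C s)).
Proof.
rewrite /diag_elt mulr_sumr mulr_suml scaler_sumr (reindex_inj (@ordS_inj d)).
apply: eq_bigr => i _; rewrite -scalerAr -wc_comm -scalerAl scalerA.
congr (_ *: _); rewrite /lam mulrCA; congr (_ * _).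
by rewrite -exprS /= (prim_expr_mod q_prim).
Qed.

(* The algebra A enters only through its relations, its spanning words and its
   morphisms to the blocks. *)
Variables (A : algType K) (g x : A).
Hypotheses (gX : g ^+ n = 1) (xX : x ^+ d = mu *: (1 - g ^+ d))
  (xg : x * g = q *: (g * x)).
Hypothesis A_ind : forall P : A -> Prop, P 1 ->
  (forall c a b, P a -> P b -> P (c *: a + b)) ->
  (forall a, P a -> P (a * g)) -> (forall a, P a -> P (a * x)) ->
  forall a, P a.

Let e t : A := \sum_(k < n) coef t k *: g ^+ k.

Let e_g t : e t * g = lam t *: e t.
Proof.
(* Multiplication by g shifts the terms a k of e t cyclically up to the factor
   lam t, because a n = a 0. *)
pose a k : A := coef t k *: g ^+ k.
have a_succ k : a k * g = lam t *: a k.+1.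
  rewrite /a -scalerAl -exprSr scalerA; congr (_ *: _).
  rewrite /coef mulrCA exprS invfM; congr (_ * _).
  by rewrite mulrA mulfV ?mul1r.
have an : a n = a 0 by rewrite /a gX /coef lamn expr0 invr1.
rewrite /e mulr_suml scaler_sumr.
transitivity (\sum_(k < n) lam t *: a k.+1).
  by apply: eq_bigr => k _; apply: a_succ.
rewrite -!scaler_sumr; congr (_ *: _); apply: (addrI (a 0)).
rewrite -(big_ord_recl n (fun k : 'I_n.+1 => a k)).
by rewrite big_ord_recr /= addrC an.
Qed.

Let e_gX t k : e t * g ^+ k = lam t ^+ k *: e t.
Proof.
elim: k => [|k IHk]; first by rewrite mulr1 scale1r.
by rewrite exprSr mulrA IHk -scalerAl e_g scalerA -exprSr.
Qed.

Let e_sum : \sum_t e t = 1.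
Proof.
rewrite exchange_big /=.
transitivity (\sum_(k < n) (k == 0 :> nat)%:R *: g ^+ k : A).
  by apply: eq_bigr => k _; rewrite -scaler_suml coef_sum.
rewrite (@big_only1 _ _ _ _ (Ordinal n_gt0)) // => [|k ne_k _].
  by rewrite /= scale1r.
by rewrite -[(k == 0 :> nat)]/(k == Ordinal n_gt0) (negPf ne_k) scale0r.
Qed.

Let xX_g k : x ^+ k * g = q ^+ k *: (g * x ^+ k).
Proof.
elim: k => [|k IHk]; first by rewrite mul1r mulr1 scale1r.
rewrite [x ^+ _]exprS -[x * _ * g]mulrA IHk -scalerAr [x * (g * _)]mulrA xg.
by rewrite -scalerAl scalerA -exprSr mulrA.
Qed.

Let v (t : S * ('I_d * 'I_d)) : A := e (t.1, t.2.1) * x ^+ t.2.2.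

(* Multiplication by g rescales a monomial e_lam x^j, and multiplication by x
   raises j until x^d acts as the scalar mu (1 - lam^d) on e_lam. *)
Let v_span a : spanned v a.
Proof.
have d_gt0 := prim_order_gt0 q_prim.
have spanned_mulr y : (forall t, spanned v (v t * y)) ->
    forall a, spanned v a -> spanned v (a * y).
  move=> Sy _ [c ->]; rewrite mulr_suml; apply: spanned_sum => t.
  by rewrite -scalerAl; apply: spannedZ.
elim/A_ind: a => [|c a b Sa Sb|a|a].
- rewrite -e_sum; apply: spanned_sum => -[s i].
  by have := spanned_gen v (s, (i, Ordinal d_gt0)); rewrite /v /= mulr1.
- exact: spannedZD.
- apply: spanned_mulr => -[s [i j]]; rewrite /v /= -mulrA xX_g -scalerAr.
  rewrite mulrA e_g -scalerAl; do 2!apply: spannedZ.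
  exact: (spanned_gen v (s, (i, j))).
- apply: spanned_mulr => -[s [i j]]; rewrite /v /= -mulrA -exprSr.
  have [lt_jd|] := ltnP j.+1 d.
    exact: (spanned_gen v (s, (i, Ordinal lt_jd))).
  rewrite leq_eqVlt ltnS leqNgt ltn_ord orbF => /eqP <-.
  rewrite xX -scalerAr mulrBr mulr1 e_gX; apply: spannedZ.
  rewrite addrC -scaleNr; apply: spannedZD;
  by have := spanned_gen v (s, (i, Ordinal d_gt0)); rewrite /v /= mulr1.
Qed.

Variable f : forall s, A -> B s.
Hypotheses (f_lin : forall s, linear (f s))
  (f_mon : forall s, monoid_morphism (f s))
  (f_g : forall s, f s g = diag_elt s)
  (f_x : forall s, f s x = wc_shift (C s)).

Let f_expr s a k : f s (a ^+ k) = f s a ^+ k.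
Proof.
have [f1 fM] := f_mon s.
by elim: k => [|k IHk]; rewrite ?f1 // !exprS fM IHk.
Qed.

Let f_e s t : f s (e t) = (t.1 == s)%:R *: wc_idem (C s) t.2.
Proof.
rewrite /e (linear_combination_map _ _ (f_lin s)).
transitivity
  (\sum_(k < n) \sum_i (coef t k * lam (s, i) ^+ k) *: wc_idem (C s) i).
  apply: eq_bigr => k _; rewrite f_expr f_g diag_eltX scaler_sumr.
  by apply: eq_bigr => i _; rewrite scalerA.
rewrite exchange_big /= (@big_only1 _ _ _ _ t.2) // => [|i ne_i _].
  rewrite -scaler_suml coef_orth; congr (_%:R *: _).
  by case: t => s' i; rewrite xpair_eqE eqxx andbT.
rewrite -scaler_suml coef_orth; case: t ne_i => s' i' /= ne_i.
by rewrite xpair_eqE [i' == i]eq_sym (negPf ne_i) andbF scale0r.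
Qed.

Let f_v s t :
  f s (v t) = (t.1 == s)%:R *: (wc_idem (C s) t.2.1 * wc_shift (C s) ^+ t.2.2).
Proof.
have [_ fM] := f_mon s.
by rewrite /v fM f_e f_expr f_x -scalerAl.
Qed.

Let f_comb s (c : S * ('I_d * 'I_d) -> K) :
  f s (\sum_t c t *: v t) =
    \sum_u c (s, u) *: (wc_idem (C s) u.1 * wc_shift (C s) ^+ u.2).
Proof.
rewrite (linear_combination_map _ _ (f_lin s)).
transitivity (\sum_s' \sum_u c (s', u) *: f s (v (s', u))).
  by rewrite pair_bigA; apply: eq_bigr => -[].
rewrite (@big_only1 _ _ _ _ s) // => [|s' ne_s _].
  by apply: eq_bigr => u _; rewrite f_v eqxx scale1r.
by rewrite big1 // => u _; rewrite f_v (negPf ne_s) scale0r scaler0.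
Qed.

(** The coefficients of the components b_s on the bases of the blocks are, put
    together, the coefficients of a on the spanning family v, and each
    coefficient of a can be read in its block. *)
Theorem block_decomposition (b : forall s, B s) :
  exists! a, forall s, f s a = b s.
Proof.
have [c Dc] := choice (fun s => wc_span (C s) (b s)).
exists (\sum_t c t.1 t.2 *: v t); split=> [s|a fa].
  by rewrite Dc (f_comb s (fun t => c t.1 t.2)).
have [ca Da] := v_span a; rewrite Da; apply: eq_bigr => -[s u] _ /=.
congr (_ *: _); apply/eqP; rewrite -subr_eq0; apply/eqP.
apply: (wc_free (C := C s) (c := fun u => c s u - ca (s, u))).
under eq_bigr do rewrite scalerBl.
by rewrite sumrB -Dc -(f_comb s ca) -Da fa subrr.
Qed.
End Blocks.

(** A K-algebra structure asks for 1 != 0. A morphism to a nonzero algebra, here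
    to any block, provides it. *)
Section NontrivialA.
Variables (K : fieldType) (n d : nat) (mu q : K) (B : algType K) (G X : B).
Hypotheses (GX : G ^+ n = 1) (XX : X ^+ d = mu *: (1 - G ^+ d))
  (XG : X * G = q *: (G * X)).

Lemma algA_one_neq0 : 1 != 0 :> algA n d mu q.
Proof.
have lin := algA_eval_linear GX XX XG.
have [f1 _] := algA_eval_monoid_morphism GX XX XG.
apply/eqP => one0; have := lin (-1) 0 0; rewrite !scaleN1r !addNr -one0 f1.
by move/eqP; rewrite oner_eq0.
Qed.
End NontrivialA.

Section AlgebraAsAlgType.
Variables (K : fieldType) (n d : nat) (mu q : K).
Variable one_neq0 : 1 != 0 :> algA n d mu q.

(** A copy of A indexed by a proof that it is nonzero, to carry the K-algebra
    structure that such a proof allows. *)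
Definition nontrivial_algA of 1 != 0 :> algA n d mu q : Type := algA n d mu q.
Local Notation A := (nontrivial_algA one_neq0).

HB.instance Definition _ := GRing.PzRing.on A.
HB.instance Definition _ := GRing.Lmodule.on A.
HB.instance Definition _ := GRing.PzSemiRing_isNonZero.Build A one_neq0.
HB.instance Definition _ :=
  GRing.Lmodule_isLalgebra.Build K A (@algA_scalerAl K n d mu q).
HB.instance Definition _ :=
  GRing.LSemiAlgebra_isSemiAlgebra.Build K A (@algA_scalerAr K n d mu q).
End AlgebraAsAlgType.

Theorem algA_block_decomposition (K : fieldType) (n d : nat) (mu q : K)
    (S : finType) (r : S -> K) (n_gt0 : (0 < n)%N) (nK : n%:R != 0 :> K)
    (q_prim : d.-primitive_root q) (cardS : (#|S| * d)%N = n)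
    (rn : forall s, r s ^+ n = 1) (r_inj : injective (fun s => r s ^+ d))
    (B : S -> algType K)
    (C : forall s, weighted_cycle d (B s) (mu * (1 - r s ^+ d))) :
  exists f : forall s, algA n d mu q -> B s,
  [/\ forall s, linear (f s), forall s, monoid_morphism (f s) &
      forall b : (forall s, B s), exists! a, forall s, f s a = b s].
Proof.
have Gn s := diag_elt_order q_prim cardS rn C s.
have XX s := diag_elt_shiftX q_prim C s.
have XG s := diag_elt_comm q_prim C s.
have [s0 _] : exists s0 : S, true.
  case: (pickP (fun _ : S => true)) => [s0 _|S0]; first by exists s0.
  by move: n_gt0; rewrite -cardS (eq_card0 S0).
pose A : algType K := nontrivial_algA (algA_one_neq0 (Gn s0) (XX s0) (XG s0)).
exists (fun s => algA_eval (diag_elt q C s) (wc_shift (C s))).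
split=> [s|s|b].
- exact: algA_eval_linear (Gn s) (XX s) (XG s).
- exact: algA_eval_monoid_morphism (Gn s) (XX s) (XG s).
apply: (block_decomposition (A := A) (g := algA_g n d mu q)
  (x := algA_x n d mu q) n_gt0 nK q_prim cardS rn r_inj (C := C)).
- exact: algA_gX.
- exact: algA_xX.
- exact: algA_xg.
- exact: algA_ind.
- by move=> s; apply: algA_eval_linear (Gn s) (XX s) (XG s).
- by move=> s; apply: algA_eval_monoid_morphism (Gn s) (XX s) (XG s).
- by move=> s; apply: algA_eval_g (Gn s) (XX s) (XG s).
- by move=> s; apply: algA_eval_x (Gn s) (XX s) (XG s).
Qed.

(** * The isomorphisms *)

Lemma unique_preimage_bijective (A B : Type) (F : A -> B) :
  (forall b, exists! a, F a = b) -> bijective F.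
Proof.
move=> uF; have [h hP] := choice uF.
by exists h => [a|b]; [have [_] := hP (F a); apply | have [] := hP b].
Qed.

(** The powers z^k with k < n / d represent distinct cosets of the d-th roots
    of unity, since the exponents k d of their d-th powers stay below n. *)
Lemma primitive_root_coset_inj (K : fieldType) (n d : nat) (z : K)
    (S : Type) (rho : S -> nat) :
    n.-primitive_root z -> (0 < d)%N -> (d %| n)%N ->
    injective rho -> (forall s, rho s < n %/ d)%N ->
  injective (fun s => (z ^+ rho s) ^+ d).
Proof.
move=> zP d_gt0 dn rho_inj lt_rho s s'; rewrite -!exprM => /eqP.
have lt_n t : (rho t * d < n)%N by rewrite -ltn_divRL.
rewrite (eq_prim_root_expr zP) !modn_small // eqn_pmul2r // => /eqP.
exact: rho_inj.
Qed.

(** The blocks may be indexed by any set of n / d labels; rho gives the exponent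
    of the root that represents the coset of a label. *)
Section Decomposition.
Variables (K : fieldType) (charK : [pchar K] =i pred0)
  (rootsK : contains_all_roots_of_unity K) (n d : nat) (n_gt0 : (0 < n)%N)
  (d_gt0 : (0 < d)%N) (mu q : K) (qn : n.-unity_root q)
  (q_order : d.-primitive_root q).
Local Notation A := (algA n d mu q).

Let dn : (d %| n)%N.
Proof. by rewrite (prim_order_dvd q_order) -unity_rootE. Qed.

Lemma algA_decomposition_labelled (S : finType) (rho : S -> nat)
    (B : S -> algType K) :
    #|S| = (n %/ d)%N -> injective rho -> (forall s, rho s < n %/ d)%N ->
    (forall z : K, n.-primitive_root z ->
       forall s, weighted_cycle d (B s) (mu * (1 - (z ^+ rho s) ^+ d))) ->
  exists f : forall s, A -> B s,
    [/\ forall s, linear (f s), forall s, monoid_morphism (f s) &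
        forall b : (forall s, B s), exists! a, forall s, f s a = b s].
Proof.
move=> cardS rho_inj lt_rho C.
have [z zP] := exists_primitive_root charK rootsK n_gt0.
apply: (algA_block_decomposition (r := fun s => z ^+ rho s)) => //.
- by rewrite (iffLR (pcharf0P K) charK) -lt0n.
- by rewrite cardS divnK.
- by move=> s; rewrite exprAC (prim_expr_order zP) expr1n.
- exact: primitive_root_coset_inj lt_rho.
- exact: C.
Qed.

Lemma algA_decomposition_mu0 : mu = 0 ->
  exists f : A -> {ffun 'I_(n %/ d) -> truncated_cycle_alg K d_gt0},
    [/\ linear f, monoid_morphism f & bijective f].
Proof.
move=> mu0.
have [z zP s|f [f_lin f_mon f_bij]] := @algA_decomposition_labelled 'I_(n %/ d)
  (@nat_of_ord _) (fun=> truncated_cycle_alg K d_gt0) (card_ord _)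
  (@ord_inj _) (@ltn_ord _).
  by rewrite mu0 mul0r; apply: truncated_weighted_cycle.
exists (fun a => [ffun s => f s a]); split.
- by move=> c a b; apply/ffunP => s; rewrite !ffunE f_lin.
- split=> [|a b]; apply/ffunP => s; rewrite !ffunE; have [f1 fM] := f_mon s.
    exact: f1.
  exact: fM.
apply: unique_preimage_bijective => b; have [a [fa ua]] := f_bij b.
exists a; split=> [|a' a'b]; first by apply/ffunP => s; rewrite ffunE.
by apply: ua => s; rewrite -a'b ffunE.
Qed.
End Decomposition.

Lemma algA_decomposition_mu_neq0 (K : fieldType) (charK : [pchar K] =i pred0)
    (rootsK : contains_all_roots_of_unity K) (n d' : nat) (n_gt0 : (0 < n)%N)
    (d_gt0 : (0 < d'.+1)%N) (mu q : K) (qn : n.-unity_root q)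
    (q_order : d'.+1.-primitive_root q) :
    mu != 0 ->
  exists f : algA n d'.+1 mu q ->
      (truncated_cycle_alg K d_gt0
       * {ffun 'I_(n %/ d'.+1 - 1) -> 'M[K]_d'.+1})%type,
    [/\ linear f, monoid_morphism f & bijective f].
Proof.
(* The label None is the coset of 1, whose weight is mu (1 - 1) = 0. *)
move=> mu0; set d := d'.+1; set m := (n %/ d - 1)%N.
have dn : (d %| n)%N by rewrite (prim_order_dvd q_order) -unity_rootE.
have m1 : m.+1 = (n %/ d)%N by rewrite /m subn1 prednK // divn_gt0 // dvdn_leq.
pose rho (o : option 'I_m) : nat := oapp (fun k : 'I_m => k.+1) 0%N o.
pose B (o : option 'I_m) : algType K :=
  if o is Some _ then 'M[K]_d'.+1 else truncated_cycle_alg K d_gt0.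
have rho_inj : injective rho.
  by move=> [k|] [l|] //= [] /val_inj ->.
have lt_rho o : (rho o < n %/ d)%N.
  by rewrite -m1; case: o => //= k; rewrite ltnS.
have C (z : K) : n.-primitive_root z ->
    forall o, weighted_cycle d (B o) (mu * (1 - (z ^+ rho o) ^+ d)).
  move=> zP [k|] /=; last first.
    by rewrite expr0 expr1n subrr mulr0; apply: truncated_weighted_cycle.
  apply: matrix_weighted_cycle; rewrite mulf_neq0 // subr_eq0 eq_sym.
  apply/eqP => e; have := primitive_root_coset_inj zP d_gt0 dn rho_inj lt_rho.
  by move=> /(_ (Some k) None); rewrite /= e expr0 expr1n => /(_ erefl).
have [|f [f_lin f_mon f_bij]] := algA_decomposition_labelled charK rootsK
  n_gt0 d_gt0 qn q_order _ rho_inj lt_rho C.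
  by rewrite card_option card_ord.
exists (fun a => (f None a : truncated_cycle_alg K d_gt0,
                  [ffun k => f (Some k) a : 'M[K]_d'.+1])); split.
- move=> c a b; congr pair; first exact: (f_lin None).
  by apply/ffunP => k; rewrite !ffunE; apply: (f_lin (Some k)).
- split=> [|a b]; congr pair.
  + exact: (f_mon None).1.
  + by apply/ffunP => k; rewrite !ffunE; apply: (f_mon (Some k)).1.
  + exact: (f_mon None).2.
  + by apply/ffunP => k; rewrite !ffunE; apply: (f_mon (Some k)).2.
apply: unique_preimage_bijective => -[b0 b].
pose b' o : B o := if o is Some k then b k else b0.
have [a [fa ua]] := f_bij b'; exists a; split=> [|a' [a'0 a'b]].
  congr pair; first exact: (fa None).
  by apply/ffunP => k; rewrite ffunE; apply: (fa (Some k)).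
apply: ua => -[k|] //=.
by rewrite -a'b ffunE.
Qed.

(* {ffun 'I_k -> B} is the direct product of k copies of B. *)
Theorem theorem4p3 (K : fieldType) (charK : [pchar K] =i pred0)
    (rootsK : contains_all_roots_of_unity K)
    (n d : nat) (n_gt0 : (0 < n)%N) (d_gt0 : (0 < d)%N) (mu q : K)
    (qn : n.-unity_root q) (q_order : d.-primitive_root q) :
  (mu != 0 ->
     exists f : algA n d mu q ->
                (truncated_cycle_alg K d_gt0
                 * {ffun 'I_(n %/ d - 1) -> 'M[K]_d})%type,
       [/\ linear f, monoid_morphism f & bijective f]) /\
  (mu = 0 ->
     exists f : algA n d mu q ->
                {ffun 'I_(n %/ d) -> truncated_cycle_alg K d_gt0},
       [/\ linear f, monoid_morphism f & bijective f]).
Proof.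
split=> mu0; last exact: algA_decomposition_mu0.
case: d d_gt0 q_order => // d' d_gt0 q_order.
exact: algA_decomposition_mu_neq0.
Qed.
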